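(* Let $X$ be a one-dimensional real Hilbert space, identified with $\mathbb{R}$, and let $T\colon X\to X$ be nonexpansive with $\operatorname{Fix}T=\varnothing$. Then $T$ admits cosmic convergence, i.e., for every $x\in X$ the sequence $(Q_n(x))_{n\in\mathbb{N}}$ converges. In fact, exactly one of the following holds: (i) for every $x\in X$: $Tx>x$, $T^nx\to+\infty$, and $Q_n(x)\to+1$; (ii) for every $x\in X$: $Tx<x$, $T^nx\to-\infty$, and $Q_n(x)\to-1$.
   Context: $T$ is nonexpansive if $\|Tx-Ty\|\le\|x-y\|$ for all $x,y\in X$; $\operatorname{Fix}T=\{x\in X : Tx=x\}$. For $x\in X$, $Q_n(x):=T^nx/\|T^nx\|$, which is well defined for all sufficiently large $n$ when $\operatorname{Fix}T=\varnothing$ (since then $\|T^nx\|\to\infty$); convergence of $(Q_n(x))_{n\in\mathbb{N}}$ refers to this eventually defined sequence. *)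

(* Defs.v *)
From HB Require Import structures.
From mathcomp Require Import all_boot all_order all_algebra.
From mathcomp Require Import all_classical all_reals all_analysis.
Set Implicit Arguments.
Unset Strict Implicit.
Unset Printing Implicit Defensive.
Import Order.TTheory GRing.Theory Num.Theory.
Import numFieldNormedType.Exports.
Local Open Scope classical_set_scope.
Local Open Scope ring_scope.

Section Cosmic.
Context {R : realType} {X : normedModType R}.
Implicit Types (T : X -> X) (x l : X).

Definition nonexpansive T := forall x y, `|T x - T y| <= `|x - y|.

Definition Fix T : set X := [set x | T x = x].

(* At indices where [iter n T x = 0] this is the junk value [0]; [Q_cvgto]
   below requires that this happens only finitely often. *)
Definition Q T x (n : nat) : X := `|iter n T x|^-1 *: iter n T x.

Definition Q_cvgto T x l :=
  (\forall n \near \oo, iter n T x != 0) /\ Q T x n @[n --> \oo] --> l.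

Definition cosmic_convergence T := forall x, exists l, Q_cvgto T x l.

End Cosmic.

(* Main.v *)
(** The displacement [T x - x] is continuous and never vanishes, so it has a
    constant sign. If it is positive, every orbit is increasing, and a bounded
    orbit would converge to a fixed point, so every orbit tends to [+oo] and is
    eventually positive. The negative case follows by conjugating [T] with
    [x |-> - x]. *)
Require Import Defs.
From HB Require Import structures.
From mathcomp Require Import all_boot all_order all_algebra.
From mathcomp Require Import all_classical all_reals all_analysis.
Import Order.TTheory GRing.Theory Num.Theory.
Import numFieldNormedType.Exports.
Local Open Scope classical_set_scope.
Local Open Scope ring_scope.

Lemma nonexpansive_continuous (R : realType) (X : normedModType R)
    (T : X -> X) : nonexpansive T -> continuous T.
Proof.
move=> T1 x; apply/cvgrPdist_lt => e e0.
near=> y; apply: le_lt_trans (T1 x y) _.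
by near: y; apply: cvgr_dist_lt => //; exact: cvg_id.
Unshelve. all: by end_near. Qed.

Lemma fixpoint_free_sign (R : realType) (T : R -> R) :
  continuous T -> (forall x, T x != x) ->
  (forall x, x < T x) \/ (forall x, T x < x).
Proof.
move=> Tc T0.
have same_sign a b : a < T a -> ~~ (T b < b).
  move=> Ta; apply/negP => Tb.
  have fc : continuous (fun x => T x - x).
    by move=> x; apply: cvgB; [exact: Tc | exact: cvg_id].
  have fa : 0 < T a - a by rewrite subr_gt0.
  have fb : T b - b < 0 by rewrite subr_lt0.
  (* The order of [a] and [b] is unknown, so the intermediate value theorem is applied between their
     minimum and maximum; a zero of the displacement would be a fixed point. *)
  have [c _ /eqP] : exists2 c, c \in `[Num.min a b, Num.max a b] & T c - c = 0.
    apply: (IVT _ (continuous_subspaceT fc)).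
      by rewrite ge_min !le_max lexx.
    by case: (leP a b) => _; rewrite ge_min le_max (ltW fa) (ltW fb) ?orbT.
  by rewrite subr_eq0 (negPf (T0 c)).
(* The sign of the displacement at the reference point [0] decides its sign everywhere. *)
have [T0_gt|T0_lt] : 0 < T 0 \/ T 0 < 0.
  by case: (ltgtP 0 (T 0)) (T0 0); auto; move=> <-; rewrite eqxx.
- left=> x; move: (same_sign 0 x T0_gt).
  by rewrite -leNgt le_eqVlt eq_sym (negPf (T0 x)).
- right=> x; rewrite ltNge; apply/negP; rewrite le_eqVlt eq_sym (negPf (T0 x)).
  by move=> /(same_sign x 0)/negP; exact.
Qed.

(** The shifted orbit is the image of the orbit under [T], so it tends both to [l] and, by
    continuity, to [T l]; limits are unique. *)
Lemma iter_cvg_fixpoint (R : realType) (T : R -> R) (x l : R) :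
  continuous T -> iter n T x @[n --> \oo] --> l -> T l = l.
Proof.
move=> Tc ul.
have uS : iter n.+1 T x @[n --> \oo] --> l.
  by rewrite (cvg_shiftS (fun n => iter n T x)).
by apply: (cvg_unique _ _ uS) => //; exact: (cvg_comp _ _ ul (Tc l)).
Qed.

Lemma iter_gt_cvgy (R : realType) (T : R -> R) (x : R) :
  continuous T -> (forall y, y < T y) -> iter n T x @[n --> \oo] --> +oo.
Proof.
move=> Tc Tgt.
have u_nd : nondecreasing_seq (fun n => iter n T x).
  by apply/nondecreasing_seqP => n; rewrite iterS ltW.
(* A nondecreasing real sequence either converges, here to a forbidden fixed point, or tends to
   [+oo]. *)
have [/iter_cvg_fixpoint -/(_ Tc) Tl|] := pselect (cvgn (fun n => iter n T x)).
  by have := Tgt (limn (fun n => iter n T x)); rewrite Tl ltxx.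
exact: nondecreasing_dvgn_lt.
Qed.

(** On the line, normalizing a positive number gives exactly [1], so [Q T x] is eventually
    constant. *)
Lemma iter_cvgy_Q_cvgto (R : realType) (T : R -> R) (x : R) :
  iter n T x @[n --> \oo] --> +oo -> Q_cvgto T x 1.
Proof.
move=> /cvgryPgt/(_ 0) u_gt0; split.
  by near=> n; rewrite gt_eqF//; near: n.
apply: cvg_near_cst; near=> n.
have un : 0 < iter n T x by near: n.
by rewrite /Q gtr0_norm// /GRing.scale /= mulVf// gt_eqF.
Unshelve. all: by end_near. Qed.

Lemma iter_conjN (V : zmodType) (T : V -> V) (x : V) (n : nat) :
  iter n (fun y => - T (- y)) (- x) = - iter n T x.
Proof. by elim: n => //= n ->; rewrite opprK. Qed.

(** Conjugation by [-] negates the orbit and keeps its norms, so it negates [Q]. *)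
Lemma Q_cvgto_conjN (R : realType) (X : normedModType R) (T : X -> X) (x l : X) :
  Q_cvgto (fun y => - T (- y)) (- x) l -> Q_cvgto T x (- l).
Proof.
move=> [u0 Ql]; split.
  by near=> n; rewrite -oppr_eq0 -iter_conjN; near: n.
rewrite (_ : (fun n => _) = fun n => - Q (fun y => - T (- y)) (- x) n).
  exact: cvgN.
by apply/funext => n; rewrite /Q iter_conjN normrN scalerN opprK.
Unshelve. all: by end_near. Qed.

Theorem theorem2p1 (R : realType) (T : R -> R)
    (T_nonexp : nonexpansive T) (T_noFix : Fix T = set0) :
  let case_i := forall x : R,
    [/\ x < T x, iter n T x @[n --> \oo] --> +oo & Q_cvgto T x 1] in
  let case_ii := forall x : R,
    [/\ T x < x, iter n T x @[n --> \oo] --> -oo & Q_cvgto T x (-1)] in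
  cosmic_convergence T /\ (case_i \/ case_ii) /\ ~ (case_i /\ case_ii).
Proof.
move=> case_i case_ii.
have Tc : continuous T by exact: nonexpansive_continuous.
have T_neq x : T x != x.
  by apply/eqP => Tx; have : Fix T x by []; rewrite T_noFix.
have cases : case_i \/ case_ii.
  have [Tgt|Tlt] := fixpoint_free_sign _ _ Tc T_neq; [left|right] => x.
    have ux := iter_gt_cvgy _ _ x Tc Tgt.
    by split => //; exact: iter_cvgy_Q_cvgto.
  (* The conjugate map moves every point to the right, so the positive case applies to its orbit
     from [- x]. *)
  have Sc : continuous (fun y => - T (- y)).
    move=> y; apply: cvgN; apply: continuous_comp; last exact: Tc.
    exact: opp_continuous.
  have Sgt y : y < - T (- y) by rewrite ltrNr.
  have ux := iter_gt_cvgy _ _ (- x) Sc Sgt.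
  split => //; last exact/Q_cvgto_conjN/iter_cvgy_Q_cvgto.
  apply/cvgNry; apply: cvg_trans ux; apply: near_eq_cvg.
  by near=> n; rewrite iter_conjN.
split; last split => //.
  by case: cases => C x; have [_ _ ?] := C x; [exists 1 | exists (- 1)].
(* Both cases at [0] would give [0 < T 0 < 0]. *)
by move=> [/(_ 0)[T0gt _ _] /(_ 0)[/(lt_trans T0gt)]]; rewrite ltxx.
Unshelve. all: by end_near. Qed.
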